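(* Let $d\ge 2$, let $\mathcal{H}$ be a $d$-dimensional complex Hilbert space, and let $\mathbb{P}=\{\mathcal{P}^{(1)},\ldots,\mathcal{P}^{(M)}\}$ be a set of $M$ mutually unbiased measurements of efficiency $\varkappa$ on $\mathcal{H}$. Then for every $\alpha\in(0,2]$ and every density matrix $\rho$ on $\mathcal{H}$, $$\frac{1}{M}\sum_{\mathcal{P}\in\mathbb{P}} H_{\alpha}(\mathcal{P}|\rho)\;\geq\;\ln_{\alpha}\!\left(\frac{Md(d-1)}{M(d-1)+(\varkappa d-1)\bigl(\mathrm{Tr}(\rho^{2})d-1\bigr)}\right).$$
   Context: A density matrix on $\mathcal{H}$ is a positive semidefinite operator $\rho$ with $\mathrm{Tr}(\rho)=1$. A POVM with $d$ elements is a family of positive semidefinite operators $\{P_n\}_{n=1}^d$ on $\mathcal{H}$ with $\sum_n P_n=I$ (the identity). A set $\mathbb{P}=\{\mathcal{P}^{(1)},\ldots,\mathcal{P}^{(M)}\}$ of POVMs $\mathcal{P}^{(b)}=\{P^{(b)}_n\}_{n=1}^d$, each with $d$ elements (an indexed family, $b=1,\dots,M$), is a set of $M$ mutually unbiased measurements (MUMs) of efficiency $\varkappa$ if: (i) $\mathrm{Tr}(P^{(b)}_n)=1$ for all $b,n$; (ii) $\mathrm{Tr}(P^{(a)}_mP^{(b)}_n)=\frac1d$ for all $a\neq b$ and all $m,n$; (iii) for all $b,m,n$, $\mathrm{Tr}(P^{(b)}_mP^{(b)}_n)=\delta_{mn}\,\varkappa+(1-\delta_{mn})\frac{1-\varkappa}{d-1}$.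 Here $\varkappa$ is a real parameter, for which $1/d\le\varkappa\le 1$. Sums over $\mathcal{P}\in\mathbb{P}$ mean sums over $b=1,\dots,M$. For a POVM $\mathcal{P}=\{P_n\}_{n=1}^d$ and density matrix $\rho$, the outcome probabilities are $p_n(\mathcal{P}|\rho)=\mathrm{Tr}(P_n\rho)$, and $H_\alpha(\mathcal{P}|\rho)$ denotes the Tsallis $\alpha$-entropy of this distribution: $H_{\alpha}(p)=\frac{1}{1-\alpha}\left(\sum_n p_n^{\alpha}-1\right)$ for $\alpha>0$, $\alpha\neq1$ (with $0^\alpha=0$), and $H_1(p)=-\sum_n p_n\ln p_n$ (Shannon entropy, with $0\ln 0=0$). The $\alpha$-logarithm of $x>0$ is $\ln_{\alpha}(x)=\frac{x^{1-\alpha}-1}{1-\alpha}$ for $\alpha\neq 1$ and $\ln_1(x)=\ln x$. *)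

(* Defs.v *)
(* MathComp / MathComp-Analysis. *)
From HB Require Import structures.
From mathcomp Require Import all_boot all_order all_algebra.
From mathcomp Require Import sesquilinear spectral complex.
From mathcomp Require Import reals exp.

Set Implicit Arguments.
Unset Strict Implicit.
Unset Printing Implicit Defensive.
Import Order.TTheory GRing.Theory Num.Theory.
Local Open Scope ring_scope.
Local Open Scope sesquilinear_scope.
Local Open Scope complex_scope.

(* The d-dimensional Hilbert space is C^d, with C = R[i] and operators given by
   their matrices in an orthonormal basis. On R[i], 0 <= z means that z is real
   and nonnegative, so [psdmx A] forces A to be Hermitian. *)
Definition psdmx (R : realType) (d : nat) (A : 'M[R[i]]_d) : Prop :=
  forall v : 'cV[R[i]]_d, 0 <= (v ^t* *m A *m v) 0 0.

Definition density_matrix (R : realType) (d : nat) (rho : 'M[R[i]]_d) : Prop :=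
  psdmx rho /\ \tr rho = 1.

Definition is_povm (R : realType) (d k : nat) (P : 'I_k -> 'M[R[i]]_d) : Prop :=
  (forall n, psdmx (P n)) /\ \sum_n P n = 1%:M.

Definition is_mums (R : realType) (d M : nat) (kappa : R)
    (P : 'I_M -> 'I_d -> 'M[R[i]]_d) : Prop :=
  [/\ forall b, is_povm (P b),
      forall b n, \tr (P b n) = 1,
      forall a b m n, a != b -> \tr (P a m *m P b n) = (d%:R^-1)%:C
    & forall b m n, \tr (P b m *m P b n) =
        (if m == n then kappa else (1 - kappa) / (d%:R - 1))%:C].

(* [complex.Re] only changes the type from R[i] to R: the trace of a product of
   two positive semidefinite matrices is real. *)
Definition outcome_prob (R : realType) (d k : nat) (P : 'I_k -> 'M[R[i]]_d)
    (rho : 'M[R[i]]_d) (n : 'I_k) : R :=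
  complex.Re (\tr (P n *m rho)).

(* The conventions 0 `^ alpha = 0 (alpha != 0) and 0 * ln 0 = 0 hold for the
   library's total functions. *)
Definition tsallis (R : realType) (alpha : R) (k : nat) (p : 'I_k -> R) : R :=
  if alpha == 1 then - \sum_n p n * ln (p n)
  else (1 - alpha)^-1 * (\sum_n p n `^ alpha - 1).

Definition tsallis_povm (R : realType) (alpha : R) (d k : nat)
    (P : 'I_k -> 'M[R[i]]_d) (rho : 'M[R[i]]_d) : R :=
  tsallis alpha (outcome_prob P rho).

Definition ln_alpha (R : realType) (alpha x : R) : R :=
  if alpha == 1 then ln x else (x `^ (1 - alpha) - 1) / (1 - alpha).

(* Main.v *)
(* Centre the effects and the state: [Q b n = P b n - 1/d] and [s = rho - 1/d].
   The MUM conditions give [tr (Q b m * Q a n) = g (delta_mn - 1/d)] for [a = b]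
   and [0] otherwise, with [g = (kappa d - 1) / (d - 1)]. The coefficients
   [q b n = tr (Q b n * s) = p b n - 1/d] sum to [0] over [n], so
   [T = sum q Q] satisfies [tr (Q b n * T) = g q b n], and Cauchy-Schwarz for
   [tr (T * s)] yields [sum q^2 <= g tr s^2]. Hence the average over [b] of
   [sum_n (p b n)^2] is at most [c], the inverse of the argument of [ln_alpha].
   Moreover [H_alpha p = sum_n p n * f (p n)] with [f x = ln_alpha (1/x)], which
   is convex for [alpha <= 2]; bounding [f] below by its tangent at [c] and
   averaging gives at least [f c], because [f' c <= 0]. *)
Require Import Defs.
From mathcomp Require Import all_boot all_order all_algebra.
From mathcomp Require Import sesquilinear spectral complex.
From mathcomp Require Import reals exp.
From mathcomp Require Import ring lra.
Import Order.TTheory GRing.Theory Num.Theory.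
Local Open Scope ring_scope.
Local Open Scope sesquilinear_scope.
Local Open Scope complex_scope.

(** * Positive semidefinite matrices and traces of products *)

(** Polarization: once the diagonal vanishes, the form at [e_i + c e_j] is [c B_ij + c^* B_ji];
    taking [c] to be 1 and the imaginary unit forces [B_ij = 0]. *)
Lemma quadratic_form_eq0 (C : numClosedFieldType) n (B : 'M[C]_n) :
  (forall v : 'cV[C]_n, (v ^t* *m B *m v) 0 0 = 0) -> B = 0.
Proof.
move=> B0.
have entry i j :
    ((delta_mx 0 i : 'rV_n) *m B *m (delta_mx j 0 : 'cV_n)) 0 0 = B i j.
  by rewrite -rowE -colE !mxE.
have polar c i j :
    B i i + c * B i j + c^* * B j i + c * c^* * B j j = 0.
  rewrite -[RHS](B0 (delta_mx i 0 + c *: delta_mx j 0)).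
  have -> : (delta_mx i 0 + c *: delta_mx j 0 : 'cV[C]_n) ^t* =
            delta_mx 0 i + c^* *: delta_mx 0 j.
    apply/matrixP=> a b; rewrite !mxE rmorphD rmorphM /= !rmorph_nat.
    by rewrite ![(b == _) && _]andbC.
  rewrite !mulmxDl !mulmxDr -!scalemxAl -!scalemxAr scalerA.
  by rewrite 3![(_ + _ : 'M__) 0 0]mxE ![(_ *: _ : 'M__) 0 0]mxE !entry; ring.
have diag i : B i i = 0.
  by have := B0 (delta_mx i 0); rewrite trmx_delta map_delta_mx entry.
apply/matrixP=> i j; rewrite mxE.
have := polar 1 i j; have := polar 'i%R i j.
rewrite !diag conjCi conjC1 !mulr0 !addr0 !add0r !mul1r => h1 h2.
have h3 : 'i%R * (B i j - B j i) = 0 by rewrite -[RHS]h1; ring.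
move/eqP: h3; rewrite mulf_eq0 (negbTE (neq0Ci _)) /= => /eqP h3.
have h4 : 2%:R * B i j = 0 by rewrite -[RHS]addr0 -{1}h2 -h3; ring.
by move/eqP: h4; rewrite mulf_eq0 pnatr_eq0 /= => /eqP.
Qed.

(** The form of [A ^t*] is the conjugate of that of [A], which is real, so [A ^t* - A] has zero
    quadratic form. *)
Lemma psdmx_hermitian (R : realType) d (A : 'M[R[i]]_d) : psdmx A -> A ^t* = A.
Proof.
move=> Apsd; apply/eqP; rewrite -subr_eq0; apply/eqP.
apply: quadratic_form_eq0 => v.
rewrite mulmxBr mulmxBl mxE [X in _ + X]mxE.
have -> : (v ^t* *m A ^t* *m v) 0 0 = ((v ^t* *m A *m v) ^t*) 0 0.
  by rewrite !trmx_mul !map_mxM trmxCK mulmxA.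
by rewrite 2!mxE; apply/eqP; rewrite subr_eq0; apply/eqP/CrealP/ger0_real.
Qed.

(** Diagonalizing [B] by a unitary [U] turns the trace into a sum of eigenvalues of [B] times
    diagonal entries of [U A U^*], all nonnegative. *)
Lemma mxtrace_psd_mul_ge0 (R : realType) d (A B : 'M[R[i]]_d) :
  psdmx A -> psdmx B -> 0 <= \tr (A *m B).
Proof.
move=> Apsd Bpsd.
have Bnormal : B \is normalmx.
  by apply/normalmxP; rewrite psdmx_hermitian.
have diag_ge0 (U D : 'M[R[i]]_d) k : psdmx D -> 0 <= (U *m D *m U ^t*) k k.
  move=> /(_ ((row k U) ^t*)); rewrite trmxCK.
  rewrite -row_mul => h; apply: le_trans h _.
  rewrite !mxE le_eqVlt; apply/orP; left; apply/eqP.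
  by apply: eq_bigr => j _; rewrite !mxE.
have [U [sp [/unitarymxP Uu BE]]] : exists (U : 'M_d) (sp : 'rV_d),
    U \is unitarymx /\ B = U ^t* *m diag_mx sp *m U.
  exists (spectralmx B), (spectral_diag B); split; first exact: spectral_unitarymx.
  by rewrite -invmx_unitary ?spectral_unitarymx //; apply/orthomx_spectralP.
have sp_ge0 k : 0 <= sp 0 k.
  have := diag_ge0 U B k Bpsd.
  rewrite BE !mulmxA Uu mul1mx -mulmxA Uu mulmx1.
  by rewrite !mxE eqxx.
rewrite BE !mulmxA mxtrace_mulC !mulmxA; apply: sumr_ge0 => k _.
by rewrite mul_mx_diag mxE mulr_ge0 ?diag_ge0.
Qed.

Lemma mxtrace_hermitian_sq_ge0 (C : numClosedFieldType) n (A : 'M[C]_n) :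
  A ^t* = A -> 0 <= \tr (A *m A).
Proof.
move=> AE; rewrite -{2}AE; apply: sumr_ge0 => i _; rewrite mxE.
by apply: sumr_ge0 => j _; rewrite !mxE mul_conjC_ge0.
Qed.

(** * Cauchy-Schwarz bound on the squared outcome probabilities *)

(** Cauchy-Schwarz in quadratic form: with [S] the sum of squares and [V = tr s^2], the trace of
    [(t s - T)^2] is [t^2 V - 2 t S + g S], nonnegative for every real [t]. *)
Lemma sum_sqr_frame_le (R : realType) d (I : finType)
    (Q : I -> 'M[R[i]]_d) (s : 'M[R[i]]_d) (q : I -> R) (g : R) :
  0 <= g -> (forall i, Q i ^t* = Q i) -> s ^t* = s ->
  (forall i, \tr (Q i *m s) = (q i)%:C) ->
  (forall i, \tr (Q i *m \sum_j (q j)%:C *: Q j) = (g * q i)%:C) ->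
  \sum_i q i ^+ 2 <= g * complex.Re (\tr (s *m s)).
Proof.
move=> g_ge0 Qh sh Qs QT.
set T := \sum_j _ in QT; set S := \sum_i _; set V := complex.Re _.
have Th : T ^t* = T.
  apply/matrixP => a b; rewrite !mxE !summxE rmorph_sum; apply: eq_bigr => i _.
  rewrite -[in RHS]Qh !mxE rmorphM; congr (_ * _).
  exact: conjc_real.
have ss : \tr (s *m s) = V%:C.
  by rewrite /V RRe_real // ger0_real // mxtrace_hermitian_sq_ge0.
have Ts : \tr (T *m s) = S%:C.
  rewrite mulmx_suml !raddf_sum; apply: eq_bigr => i _ /=.
  by rewrite -scalemxAl mxtraceZ Qs -rmorphM.
have TT : \tr (T *m T) = (g * S)%:C.
  rewrite {1}/T mulmx_suml mulr_sumr !raddf_sum; apply: eq_bigr => i _ /=.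
  rewrite -scalemxAl mxtraceZ QT -rmorphM; congr (_ %:C); ring.
have quad t : 0 <= t ^+ 2 * V - 2 * t * S + g * S.
  rewrite -lecR.
  have <- : \tr ((t%:C *: s - T) *m (t%:C *: s - T)) =
            (t ^+ 2 * V - 2 * t * S + g * S)%:C.
    rewrite mulmxBl !mulmxBr -!scalemxAl -!scalemxAr !raddfB /= !mxtraceZ.
    rewrite (mxtrace_mulC s T) ss Ts TT !(rmorphD, rmorphN, rmorphM, rmorphXn) /=.
    ring.
  apply: mxtrace_hermitian_sq_ge0.
  apply/matrixP => a b; rewrite -{2}sh -{2}Th !mxE rmorphB rmorphM; congr (_ * _ - _).
  exact: conjc_real.
have V_ge0 : 0 <= V by rewrite -lecR -ss mxtrace_hermitian_sq_ge0.
have [S_le0|S_gt0] := leP S 0; first exact: le_trans (mulr_ge0 g_ge0 V_ge0).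
have [V0|V_neq0] := eqVneq V 0.
  (* If [V = 0], the value at [t = g + 1] is [-(g + 2) S], negative for [S > 0]. *)
  have := quad (g + 1); rewrite V0; nra.
have V_gt0 : 0 < V by rewrite lt_neqAle eq_sym V_neq0.
(* The minimizer of the quadratic in [t]. *)
have := quad (S / V).
have -> : (S / V) ^+ 2 * V - 2 * (S / V) * S + g * S = S / V * (g * V - S).
  by field.
by rewrite pmulr_rge0 ?divr_gt0 // subr_ge0.
Qed.

Lemma outcome_probE (R : realType) d k (P : 'I_k -> 'M[R[i]]_d) rho n :
  psdmx (P n) -> psdmx rho -> \tr (P n *m rho) = (outcome_prob P rho n)%:C.
Proof.
by move=> Pn_psd rho_psd; rewrite RRe_real // ger0_real // mxtrace_psd_mul_ge0.
Qed.

Lemma outcome_prob_ge0 (R : realType) d k (P : 'I_k -> 'M[R[i]]_d) rho n :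
  psdmx (P n) -> psdmx rho -> 0 <= outcome_prob P rho n.
Proof.
by move=> Pn_psd rho_psd; rewrite -ler0c -outcome_probE // mxtrace_psd_mul_ge0.
Qed.

Lemma sum_outcome_prob (R : realType) d k (P : 'I_k -> 'M[R[i]]_d) rho :
  is_povm P -> density_matrix rho -> \sum_n outcome_prob P rho n = 1.
Proof.
move=> [P_psd sumP] [rho_psd trrho]; apply: (@complexI R).
rewrite rmorph_sum rmorph1 /= -trrho -[rho in RHS]mul1mx -sumP.
rewrite mulmx_suml raddf_sum; apply: eq_bigr => n _ /=.
apply: esym; exact: (outcome_probE _ _ _ P rho n (P_psd n) rho_psd).
Qed.

Lemma trmxC_sub_scalar (R : realType) d (A : 'M[R[i]]_d) (x : R) :
  A ^t* = A -> (A - x%:C%:M) ^t* = A - x%:C%:M.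
Proof.
move=> Ah; apply/matrixP=> i j; rewrite -{2}Ah !mxE rmorphB rmorphMn eq_sym.
congr (_ - _ *+ _); exact: conjc_real.
Qed.

Lemma mxtrace_mul_centered (F : fieldType) d (A B : 'M[F]_d) :
  d%:R != 0 :> F -> \tr A = 1 -> \tr B = 1 ->
  \tr ((A - d%:R^-1%:M) *m (B - d%:R^-1%:M)) = \tr (A *m B) - d%:R^-1.
Proof.
move=> d_neq0 trA trB; rewrite mulmxBl !mulmxBr mul_mx_scalar !mul_scalar_mx.
rewrite !raddfB /= !mxtraceZ trA trB mxtrace_scalar.
by rewrite -[_^-1 *+ d]mulr_natr mulVf //; ring.
Qed.

(** The frame bound, indexed by pairs [(b, n)], for the centred effects; undoing the centring adds
    [M / d] to the left side and turns [tr s^2] into [tr rho^2 - 1/d]. *)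
Lemma mums_index_coincidence (R : realType) (d M : nat) (kappa : R)
    (P : 'I_M -> 'I_d -> 'M[R[i]]_d) (rho : 'M[R[i]]_d) :
  (2 <= d)%N -> d%:R^-1 <= kappa -> is_mums kappa P -> density_matrix rho ->
  \sum_(b < M) \sum_(n < d) outcome_prob (P b) rho n ^+ 2 <=
  (M%:R * (d%:R - 1) +
    (kappa * d%:R - 1) * (complex.Re (\tr (rho *m rho)) * d%:R - 1)) /
  (d%:R * (d%:R - 1)).
Proof.
move=> d_ge2 kappa_ge [Ppovm trP unbiased effic] rho_density.
have [rho_psd trrho] := rho_density.
have d_gt1 : 1 < d%:R :> R by rewrite ltr1n.
have d_gt0 : 0 < d%:R :> R by exact: lt_trans d_gt1.
have d_neq0 : d%:R != 0 :> R by rewrite gt_eqF.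
have kd_ge0 : 0 <= kappa * d%:R - 1 by rewrite subr_ge0 -ler_pdivrMr // mul1r.
have P_psd b n : psdmx (P b n) by have [h _] := Ppovm b; exact: h.
pose c := (d%:R^-1 : R)%:C.
pose p b n := outcome_prob (P b) rho n.
pose g := (kappa * d%:R - 1) / (d%:R - 1).
pose Q (i : 'I_M * 'I_d) := P i.1 i.2 - c%:M.
pose s := rho - c%:M.
have pE b n : \tr (P b n *m rho) = (p b n)%:C.
  exact: (outcome_probE _ _ _ _ _ _ (P_psd b n) rho_psd).
have trC (A B : 'M[R[i]]_d) : \tr A = 1 -> \tr B = 1 ->
    \tr ((A - c%:M) *m (B - c%:M)) = \tr (A *m B) - c.
  rewrite /c rmorphV ?unitfE //= rmorph_nat; apply: mxtrace_mul_centered.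
  by rewrite pnatr_eq0 -lt0n ltnW.
have sum_p b : \sum_n p b n = 1 by exact: sum_outcome_prob.
have frame : \sum_(i : 'I_M * 'I_d) (p i.1 i.2 - d%:R^-1) ^+ 2 <=
    g * complex.Re (\tr (s *m s)).
  apply: (@sum_sqr_frame_le _ _ _ Q).
  - by rewrite divr_ge0 // subr_ge0 ltW.
  - case=> b n; exact: trmxC_sub_scalar _ _ _ _ (psdmx_hermitian _ _ _ (P_psd b n)).
  - exact: trmxC_sub_scalar _ _ _ _ (psdmx_hermitian _ _ _ rho_psd).
  - by case=> b n; rewrite /Q /s trC // pE -rmorphB.
  case=> b n; rewrite mulmx_sumr raddf_sum /= -(pair_bigA _ (fun a m =>
    \tr (Q (b, n) *m ((p a m - d%:R^-1)%:C *: Q (a, m))))) /=.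
  (* Distinct measurements are orthogonal after centring, so only the block of [b] survives. *)
  rewrite (bigD1 b) //= [X in _ + X]big1 ?addr0; last first.
    move=> a ab; rewrite big1 // => m _.
    by rewrite -scalemxAr mxtraceZ trC // unbiased 1?eq_sym // subrr mulr0.
  under eq_bigr do rewrite -scalemxAr mxtraceZ trC // effic -rmorphB -rmorphM.
  rewrite -rmorph_sum /=; congr (_ %:C).
  (* Within a block, [kappa - 1/d = g (1 - 1/d)] and [(1 - kappa) / (d - 1) - 1/d = - g / d]; the
     part with factor [g / d] then sums to zero because the probabilities sum to 1. *)
  under eq_bigr => m _.
    have -> : (p b m - d%:R^-1) *
        ((if n == m then kappa else (1 - kappa) / (d%:R - 1)) - d%:R^-1) =
        (if m == n then g * (p b m - d%:R^-1) else 0) -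
        g / d%:R * (p b m - d%:R^-1).
      by rewrite /g eq_sym; case: eqP => _; field; rewrite d_neq0 subr_eq0 gt_eqF.
    over.
  rewrite sumrB -big_mkcond /= big_pred1_eq -mulr_sumr sumrB sum_p.
  by rewrite sumr_const card_ord -[_^-1 *+ d]mulr_natr mulVf //
    subrr mulr0 subr0.
have ssE : complex.Re (\tr (s *m s)) = complex.Re (\tr (rho *m rho)) - d%:R^-1.
  by rewrite /s trC // raddfB.
rewrite ssE -(pair_bigA _ (fun b n => (p b n - d%:R^-1) ^+ 2)) /= in frame.
have sum_sq : \sum_(b < M) \sum_(n < d) (p b n - d%:R^-1) ^+ 2 =
    \sum_(b < M) \sum_(n < d) p b n ^+ 2 - M%:R / d%:R.
  under eq_bigr => b _.
    under eq_bigr do rewrite sqrrB.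
    rewrite big_split sumrB /= sumr_const card_ord sumrMnl -mulr_suml sum_p mul1r.
    have -> : \sum_n p b n ^+ 2 - d%:R^-1 *+ 2 + d%:R^-1 ^+ 2 *+ d =
        \sum_n p b n ^+ 2 - d%:R^-1.
      by rewrite -[_ *+ d]mulr_natr; field.
    over.
  by rewrite sumrB sumr_const card_ord -[_ *+ M]mulr_natl.
rewrite sum_sq lerBlDr in frame; apply: le_trans frame _.
rewrite le_eqVlt; apply/orP; left; apply/eqP; rewrite /g.
by field; rewrite d_neq0 subr_eq0 gt_eqF.
Qed.

(** * Tangent bounds for powers, the [alpha]-logarithm and the entropy *)

Lemma ln_le_subr1 (R : realType) (x : R) : 0 < x -> ln x <= x - 1.
Proof.
by move=> x_gt0; rewrite -{1}[x](subrKC 1) le_ln1Dx // ltrBrDl subrr.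
Qed.

Lemma powR_le_tangent1 (R : realType) (b t : R) : 0 <= b <= 1 -> 0 < t ->
  t `^ b <= 1 + b * (t - 1).
Proof.
move=> /andP[b_ge0 b_le1] t_gt0; set u := 1 + _.
have u_gt0 : 0 < u by rewrite /u; nra.
rewrite -ler_ln ?posrE ?powR_gt0 // ln_powR.
(* Concavity of [ln]: the bounds at [t / u] and [1 / u], weighted by [b] and [1 - b], have right
   sides adding up to zero, giving [b ln t <= ln u]. *)
have := ln_le_subr1 _ _ (divr_gt0 t_gt0 u_gt0).
have := @ln_le_subr1 _ u^-1; rewrite invr_gt0 => /(_ u_gt0).
rewrite ln_div ?posrE // lnV ?posrE // => h1 h2.
have h : b * (t / u - 1) + (1 - b) * (u^-1 - 1) = 0.
  rewrite [LHS](_ : _ = (b * t - b + 1) / u - 1); last by field; rewrite gt_eqF.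
  by rewrite [X in X / _](_ : _ = u) ?divff ?subrr ?gt_eqF // /u; ring.
nra.
Qed.

Lemma powR_ge_tangent1 (R : realType) (b t : R) : b <= 0 -> 0 < t ->
  1 + b * (t - 1) <= t `^ b.
Proof.
move=> b_le0 t_gt0; rewrite /powR gt_eqF //.
apply: le_trans (expR_ge1Dx _); rewrite lerD2l ler_wnM2l //.
exact: ln_le_subr1.
Qed.

(** The left side is the tangent at [c] of the convex function [x |-> ln_alpha (1/x)], whose slope
    there is [- c^(alpha - 2)]. Rescaling to [t = x / c] reduces the claim to Bernoulli inequalities
    with exponent [b = alpha - 1]. *)
Lemma ln_alpha_inv_ge_tangent (R : realType) (alpha c x : R) :
  alpha <= 2 -> 0 < c -> 0 < x ->
  ln_alpha alpha c^-1 - c `^ (alpha - 2) * (x - c) <= ln_alpha alpha x^-1.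
Proof.
move=> alpha_le2 c_gt0 x_gt0; rewrite /ln_alpha.
have t_gt0 : 0 < x / c by rewrite divr_gt0.
have [->|alpha_neq1] := eqVneq alpha 1.
  have -> : 1 - 2 = -1 :> R by ring.
  rewrite powR_inv1 ?(ltW c_gt0) // !lnV ?posrE //.
  have := ln_le_subr1 _ _ t_gt0; rewrite ln_div ?posrE //.
  have -> : c^-1 * (x - c) = x / c - 1 by field; rewrite gt_eqF.
  lra.
have inv y : 0 < y -> y^-1 `^ (1 - alpha) = y `^ (alpha - 1).
  by move=> y0; rewrite -powR_inv1 ?ltW // -powRrM mulN1r opprB.
rewrite !inv //; set b := alpha - 1.
have b_neq0 : b != 0 by rewrite subr_eq0.
have -> : 1 - alpha = - b by rewrite opprB.
have -> : c `^ (alpha - 2) = c `^ b / c.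
  rewrite -[c in _ / c]powRr1 ?(ltW c_gt0) // -powRB ?(gt_eqF c_gt0) ?implybT //.
  by congr (_ `^ _); rewrite /b; ring.
have -> : x `^ b = c `^ b * (x / c) `^ b.
  by rewrite -powRM ?ltW // mulrC divfK // gt_eqF.
have cb_gt0 : 0 < c `^ b by rewrite powR_gt0.
rewrite -subr_ge0.
have -> : (c `^ b * (x / c) `^ b - 1) / - b -
    ((c `^ b - 1) / - b - c `^ b / c * (x - c)) =
    c `^ b * ((1 + b * (x / c - 1) - (x / c) `^ b) / b).
  by field; rewrite b_neq0 gt_eqF.
apply: mulr_ge0; first exact: ltW.
(* The numerator has the sign of [b]; in the positive case [alpha <= 2] supplies [b <= 1]. *)
have [b_gt0|b_le0] := ltP 0 b.
  rewrite divr_ge0 ?(ltW b_gt0) // subr_ge0 powR_le_tangent1 // ltW //=.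
  by rewrite /b; lra.
rewrite -mulrNN mulr_ge0 // ?oppr_ge0 ?invr_le0 //.
by rewrite subr_le0 powR_ge_tangent1.
Qed.

(** For [alpha != 1], writing the subtracted 1 as the sum of the [p n] lets each term factor through
    [p n]; zero probabilities contribute nothing on either side. *)
Lemma tsallis_sum_ln_alpha (R : realType) (alpha : R) k (p : 'I_k -> R) :
  alpha != 0 -> (forall n, 0 <= p n) -> \sum_n p n = 1 ->
  tsallis alpha p = \sum_n p n * ln_alpha alpha (p n)^-1.
Proof.
move=> alpha_neq0 p_ge0 sum_p; rewrite /tsallis /ln_alpha.
case: eqVneq => [_|alpha_neq1].
  rewrite -sumrN; apply: eq_bigr => n _; rewrite -mulrN.
  have [->|p_neq0] := eqVneq (p n) 0; first by rewrite !mul0r.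
  by rewrite lnV // posrE lt_neqAle eq_sym p_neq0 p_ge0.
rewrite -[X in _ * (_ - X)]sum_p -sumrB mulr_sumr; apply: eq_bigr => n _.
have [->|p_neq0] := eqVneq (p n) 0; first by rewrite powR0 // subrr mulr0 mul0r.
have p_gt0 : 0 < p n by rewrite lt_neqAle eq_sym p_neq0 p_ge0.
have -> : (p n)^-1 `^ (1 - alpha) = p n `^ alpha / p n.
  rewrite -[in LHS]powR_inv1 // -powRrM mulN1r opprB powRB ?powRr1 ?p_neq0 ?implybT //.
by field; rewrite p_neq0 subr_eq0 eq_sym alpha_neq1.
Qed.

(** Weighting the tangent bound at [p n] by [p n] and summing makes the linear term the index of
    coincidence. *)
Lemma tsallis_ge_tangent (R : realType) (alpha c : R) k (p : 'I_k -> R) :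
  0 < alpha <= 2 -> 0 < c -> (forall n, 0 <= p n) -> \sum_n p n = 1 ->
  ln_alpha alpha c^-1 - c `^ (alpha - 2) * (\sum_n p n ^+ 2 - c) <=
  tsallis alpha p.
Proof.
move=> /andP[alpha_gt0 alpha_le2] c_gt0 p_ge0 sum_p.
rewrite tsallis_sum_ln_alpha ?gt_eqF //.
have -> : ln_alpha alpha c^-1 - c `^ (alpha - 2) * (\sum_n p n ^+ 2 - c) =
    \sum_n p n * (ln_alpha alpha c^-1 - c `^ (alpha - 2) * (p n - c)).
  under [RHS]eq_bigr => n _.
    have -> : p n * (ln_alpha alpha c^-1 - c `^ (alpha - 2) * (p n - c)) =
      p n * (ln_alpha alpha c^-1 + c `^ (alpha - 2) * c) -
      c `^ (alpha - 2) * p n ^+ 2 by ring.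
    over.
  by rewrite sumrB -mulr_suml -mulr_sumr sum_p; ring.
apply: ler_sum => n _; have [->|p_neq0] := eqVneq (p n) 0; first by rewrite !mul0r.
by rewrite ler_wpM2l // ln_alpha_inv_ge_tangent // lt_neqAle eq_sym p_neq0 p_ge0.
Qed.

(** * Purity, and averaging over the measurements *)

(** The squared norm of [rho - 1/d] is [tr rho^2 - 1/d]. This keeps the denominator in the entropy
    bound positive. *)
Lemma mxtrace_density_sq_ge (R : realType) d (rho : 'M[R[i]]_d) :
  (0 < d)%N -> density_matrix rho -> 1 <= complex.Re (\tr (rho *m rho)) * d%:R.
Proof.
move=> d_gt0 [rho_psd trrho].
have dR_gt0 : 0 < d%:R :> R by rewrite ltr0n.
pose c := (d%:R^-1 : R)%:C.
have : 0 <= \tr ((rho - c%:M) *m (rho - c%:M)).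
  apply/mxtrace_hermitian_sq_ge0/trmxC_sub_scalar; exact: psdmx_hermitian.
rewrite {1 2}/c rmorphV ?unitfE ?gt_eqF //= rmorph_nat.
rewrite mxtrace_mul_centered //; last by rewrite pnatr_eq0 -lt0n.
rewrite -[d%:R](rmorph_nat (real_complex R)) -fmorphV.
have -> : \tr (rho *m rho) = (complex.Re (\tr (rho *m rho)))%:C.
  by rewrite RRe_real // ger0_real // mxtrace_psd_mul_ge0.
by rewrite -rmorphB ler0c subr_ge0 -ler_pdivrMr // mul1r.
Qed.

Theorem proposition4 (R : realType) (d M : nat) (hd : (2 <= d)%N)
    (hM : (0 < M)%N) (kappa : R) (hkappa : d%:R^-1 <= kappa <= 1)
    (P : 'I_M -> 'I_d -> 'M[R[i]]_d) (hP : is_mums kappa P)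
    (alpha : R) (halpha : 0 < alpha <= 2)
    (rho : 'M[R[i]]_d) (hrho : density_matrix rho) :
  ln_alpha alpha
    (M%:R * d%:R * (d%:R - 1) /
      (M%:R * (d%:R - 1) +
        (kappa * d%:R - 1) * (complex.Re (\tr (rho *m rho)) * d%:R - 1)))
  <= M%:R^-1 * \sum_(b < M) tsallis_povm alpha (P b) rho.
Proof.
have d_gt1 : 1 < d%:R :> R by rewrite ltr1n.
have d_gt0 : 0 < d%:R :> R by exact: lt_trans d_gt1.
have M_gt0 : 0 < M%:R :> R by rewrite ltr0n.
have M_neq0 : M%:R != 0 :> R by rewrite gt_eqF.
have /andP[kappa_ge _] := hkappa.
have [Ppovm _ _ _] := hP; have [rho_psd trrho] := hrho.
set D := M%:R * (d%:R - 1) + _.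
have D_gt0 : 0 < D.
  rewrite ltr_wpDr ?mulr_gt0 ?subr_gt0 // mulr_ge0 // subr_ge0.
    by rewrite -ler_pdivrMr // mul1r.
  by rewrite mxtrace_density_sq_ge // (ltn_trans _ hd).
(* The tangent point: the bound on the average index of coincidence. *)
pose c := D / (d%:R * (d%:R - 1)) / M%:R.
have c_gt0 : 0 < c by rewrite !divr_gt0 // mulr_gt0 // subr_gt0.
have -> : M%:R * d%:R * (d%:R - 1) / D = c^-1.
  by rewrite /c; field; rewrite !gt_eqF // subr_gt0.
have coincidence : \sum_(b < M) \sum_(n < d) outcome_prob (P b) rho n ^+ 2 <=
    M%:R * c.
  rewrite /c [X in _ <= X]mulrC divfK //.
  exact: mums_index_coincidence.
rewrite -(ler_pM2l M_gt0) mulVKf //.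
pose L (b : 'I_M) := ln_alpha alpha c^-1 -
  c `^ (alpha - 2) * (\sum_(n < d) outcome_prob (P b) rho n ^+ 2 - c).
apply: (@le_trans _ _ (\sum_b L b)); last first.
  apply: ler_sum => b _; apply: tsallis_ge_tangent => // [n|].
    by have [P_psd _] := Ppovm b; exact: outcome_prob_ge0.
  exact: sum_outcome_prob.
(* The constants add up to [M ln_alpha (1/c)]; the remainder is [- c^(alpha - 2)] times a quantity
   that [coincidence] makes nonpositive. *)
rewrite /L sumrB sumr_const card_ord -[ln_alpha _ _ *+ M]mulr_natl.
rewrite lerDl oppr_ge0 -mulr_sumr.
rewrite mulr_ge0_le0 ?powR_ge0 // sumrB sumr_const card_ord -[c *+ M]mulr_natl.
by rewrite subr_le0.
Qed.
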